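(* Let $G$ be a connected graph of order $n$ with minimum degree $\delta$. Then \[ GA(G)\le AG(G)\le \frac{(\delta+n-1)^2}{4\delta(n-1)}\,GA(G), \] where equality holds in the left-hand inequality if and only if $G$ is a regular graph, and equality holds in the right-hand inequality if and only if $G$ is isomorphic to $K_{1,n-1}$ or to $K_n$.
   Context: All graphs are finite, simple and undirected. $d_i$ is the degree of vertex $v_i$; $i\sim j$ denotes an edge $v_iv_j$ and sums over $i\sim j$ run over edges, each once. $AG(G)=\sum_{i\sim j}\frac12\left(\sqrt{d_i/d_j}+\sqrt{d_j/d_i}\right)$ and the first geometric-arithmetic index is $GA(G)=\sum_{i\sim j}\frac{2\sqrt{d_id_j}}{d_i+d_j}$. *)

(* Defs.v *)
From HB Require Import structures.
From mathcomp Require Import all_boot all_order all_algebra.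

Set Implicit Arguments.
Unset Strict Implicit.
Unset Printing Implicit Defensive.

Import Order.TTheory GRing.Theory Num.Theory.
Local Open Scope ring_scope.

Record sgraph := SGraph {
  vertex :> finType;
  adj : vertex -> vertex -> bool;
  adj_sym : symmetric adj;
  adj_irr : irreflexive adj }.

Definition deg (G : sgraph) (u : G) : nat := #|[set v | adj u v]|.

Definition connected_graph (G : sgraph) : Prop :=
  (0 < #|G|)%N /\ forall u v : G, connect (@adj G) u v.

Definition regular_graph (G : sgraph) : Prop :=
  exists r : nat, forall u : G, deg u = r.

Definition is_min_degree (G : sgraph) (delta : nat) : Prop :=
  (exists u : G, deg u = delta) /\ (forall u : G, (delta <= deg u)%N).

Definition graph_iso (G H : sgraph) : Prop :=
  exists2 f : G -> H, bijective f & forall u v : G, adj (f u) (f v) = adj u v.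

Definition complete_adj (n : nat) (i j : 'I_n) : bool := i != j.

Lemma complete_adj_sym n : symmetric (@complete_adj n).
Proof. by move=> i j; rewrite /complete_adj eq_sym. Qed.

Lemma complete_adj_irr n : irreflexive (@complete_adj n).
Proof. by move=> i; rewrite /complete_adj eqxx. Qed.

Definition complete_graph (n : nat) : sgraph :=
  SGraph (@complete_adj_sym n) (@complete_adj_irr n).

Definition bipartite_adj (m k : nat) (x y : 'I_m + 'I_k) : bool :=
  match x, y with
  | inl _, inr _ | inr _, inl _ => true
  | _, _ => false
  end.

Lemma bipartite_adj_sym m k : symmetric (@bipartite_adj m k).
Proof. by case=> ? []. Qed.

Lemma bipartite_adj_irr m k : irreflexive (@bipartite_adj m k).
Proof. by case. Qed.

Definition complete_bipartite_graph (m k : nat) : sgraph :=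
  SGraph (@bipartite_adj_sym m k) (@bipartite_adj_irr m k).

(* [enum_rank] labels the vertices 0, ..., n-1, and the edge {u, v} is counted
   once, as the ordered pair whose first component has the smaller label.  The
   choice of labelling is immaterial for an [F] that is symmetric in [u, v]. *)
Definition edge_sum (R : rcfType) (G : sgraph) (F : G -> G -> R) : R :=
  \sum_(u : G) \sum_(v : G | adj u v && (enum_rank u < enum_rank v)%N) F u v.

Definition AG (R : rcfType) (G : sgraph) : R :=
  edge_sum (fun u v : G =>
    2^-1 * (Num.sqrt ((deg u)%:R / (deg v)%:R)
            + Num.sqrt ((deg v)%:R / (deg u)%:R))).

Definition GA (R : rcfType) (G : sgraph) : R :=
  edge_sum (fun u v : G =>
    2 * Num.sqrt ((deg u)%:R * (deg v)%:R) / ((deg u)%:R + (deg v)%:R)).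

(* Main.v *)
(** On an edge whose ends have degrees [a] and [b], the [AG] term over the [GA]
    term is [(a + b)^2 / (4ab)].  This ratio is at least [1], with equality iff
    [a = b].  Since [(d + m)^2 ab - dm (a + b)^2 = (am - bd)(bm - ad)], for
    [0 < d <= a, b <= m] it is at most [(d + m)^2 / (4dm)], with equality iff
    [{a, b} = {d, m}].  Both bounds follow by summing over the edges with
    [d = delta] and [m = n - 1].  When every edge has end degrees
    [{delta, n - 1}], either [G] is complete, or [delta < n - 1] and a vertex of
    degree [n - 1] is adjacent to all the others, which then have degree
    [delta] and are pairwise non-adjacent, so that [G] is a star. *)
Require Import Defs.
From HB Require Import structures.
From mathcomp Require Import all_boot all_order all_algebra.
From mathcomp Require Import ring zify.

Set Implicit Arguments.
Unset Strict Implicit.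
Unset Printing Implicit Defensive.

Import Order.TTheory GRing.Theory Num.Theory.
Local Open Scope ring_scope.

(** * Inequalities for a single edge, with real end degrees *)

Section EdgeTerms.
Variable R : rcfType.
Implicit Types a b c d m : R.

Definition ag_term a b : R := 2^-1 * (Num.sqrt (a / b) + Num.sqrt (b / a)).
Definition ga_term a b : R := 2 * Num.sqrt (a * b) / (a + b).

(** One identity serves both bounds: [c = 1] makes the numerator [-(a - b)^2], and
    [c = (d + m)^2 / (4dm)] makes it factor. Writing [a = x^2] and [b = y^2] turns it into a
    rational identity in [x] and [y]. *)
Lemma scaled_ga_sub_ag c a b : 0 < a -> 0 < b ->
  c * ga_term a b - ag_term a b
  = (4 * c * a * b - (a + b) ^+ 2) / (2 * Num.sqrt (a * b) * (a + b)).
Proof.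
move=> a0 b0; rewrite /ga_term /ag_term.
rewrite !sqrtrM ?ltW // !sqrtrV ?ltW //.
have x0 : 0 < Num.sqrt a by rewrite sqrtr_gt0.
have y0 : 0 < Num.sqrt b by rewrite sqrtr_gt0.
have ea : a = Num.sqrt a ^+ 2 by rewrite sqr_sqrtr // ltW.
have eb : b = Num.sqrt b ^+ 2 by rewrite sqr_sqrtr // ltW.
move: (Num.sqrt a) (Num.sqrt b) x0 y0 ea eb => x y x0 y0 -> ->.
by field; do ![apply/andP; split]; rewrite ?lt0r_neq0 ?addr_gt0 ?exprn_gt0.
Qed.

Lemma ag_ga_denom_gt0 a b : 0 < a -> 0 < b ->
  0 < 2 * Num.sqrt (a * b) * (a + b).
Proof. by move=> a0 b0; rewrite !mulr_gt0 ?addr_gt0 ?sqrtr_gt0 ?mulr_gt0. Qed.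

Lemma ga_ag_leif a b : 0 < a -> 0 < b ->
  ga_term a b <= ag_term a b ?= iff (a == b).
Proof.
move=> a0 b0; have D0 := ag_ga_denom_gt0 a0 b0.
have E : ag_term a b - ga_term a b
         = (a - b) ^+ 2 / (2 * Num.sqrt (a * b) * (a + b)).
  rewrite -opprB -[ga_term a b]mul1r (scaled_ga_sub_ag 1 a0 b0) -mulNr.
  by congr (_ / _); ring.
split.
  by rewrite -subr_ge0 E divr_ge0 ?sqr_ge0 ?ltW.
rewrite eq_sym -subr_eq0 E mulf_eq0 invr_eq0 (gt_eqF D0) orbF.
by rewrite sqrf_eq0 subr_eq0.
Qed.

Lemma ag_scaled_ga_leif d m a b :
    0 < d -> d <= a -> a <= m -> d <= b -> b <= m ->
  ag_term a b <= (d + m) ^+ 2 / (4 * d * m) * ga_term a b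
    ?= iff ((a == d) && (b == m)) || ((a == m) && (b == d)).
Proof.
move=> d0 da am db bm.
have a0 : 0 < a by apply: lt_le_trans da.
have b0 : 0 < b by apply: lt_le_trans db.
have m0 : 0 < m by apply: lt_le_trans am.
have D0 := ag_ga_denom_gt0 a0 b0.
have E := scaled_ga_sub_ag ((d + m) ^+ 2 / (4 * d * m)) a0 b0.
have N : 4 * ((d + m) ^+ 2 / (4 * d * m)) * a * b - (a + b) ^+ 2
       = (a * m - b * d) * (b * m - a * d) / (d * m).
  by field; rewrite !lt0r_neq0.
rewrite {}N in E.
(* This treats both factors, [am - bd] and, with [a] and [b] exchanged, [bm - ad]; their zeros give
   the two disjuncts of the equality case. *)
have key x y : d <= x -> y <= m -> 0 < y -> y * d <= x * m ?= iff (x == d) && (y == m).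
  move=> dx ym y0; split; first by rewrite mulrC ler_pM // ltW.
  apply/eqP/andP => [e|[/eqP-> /eqP->]]; last by rewrite mulrC.
  (* From [y * d = x * m] and [y <= m] follows [x * m <= d * m], hence [x <= d]. *)
  have xd : x = d.
    apply/eqP; rewrite eq_le dx andbT -(ler_pM2r m0) -e mulrC.
    by rewrite ler_pM2l.
  split; first exact/eqP.
  by apply/eqP/(mulIf (lt0r_neq0 d0)); rewrite e xd mulrC.
have [le1 eq1] := key a b da bm b0.
have [le2 eq2] := key b a db am a0.
split.
  rewrite -subr_ge0 E divr_ge0 ?(ltW D0) // divr_ge0 ?(ltW (mulr_gt0 d0 m0)) //.
  by rewrite mulr_ge0 ?subr_ge0 ?le1 ?le2.
rewrite eq_sym -subr_eq0 E mulf_eq0 invr_eq0 (gt_eqF D0) orbF.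
rewrite mulf_eq0 invr_eq0 (gt_eqF (mulr_gt0 d0 m0)) orbF mulf_eq0 !subr_eq0.
by rewrite [a * m == _]eq_sym eq1 [b * m == _]eq_sym eq2 [(b == d) && _]andbC.
Qed.

End EdgeTerms.

(** * From edges to sums over edges *)

(** [edge_sum] visits each edge in one orientation, so equality of the sums gives [C u v] only with
    the smaller label first; symmetry of [C] recovers the other orientation. *)
Lemma edge_sum_leif (R : rcfType) (G : sgraph) (F H : G -> G -> R)
    (C : G -> G -> bool) :
    (forall u v, C u v = C v u) ->
    (forall u v, adj u v -> F u v <= H u v ?= iff C u v) ->
  edge_sum F <= edge_sum H ?= iff [forall u, forall v, adj u v ==> C u v].
Proof.
move=> symC leFH; rewrite /edge_sum !pair_big_dep /=.
have := @leif_sum R (G * G)%type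
  (fun p => adj p.1 p.2 && (enum_rank p.1 < enum_rank p.2)%N)
  (fun p => C p.1 p.2) (fun p => F p.1 p.2) (fun p => H p.1 p.2).
case=> [[u v] /= /andP[uv _]|le eq]; first exact: leFH.
split=> //; rewrite eq; apply/'forall_implyP/'forall_forallP => [allC u v|allC [u v]].
  apply/implyP => uv; case: (ltngtP (enum_rank u) (enum_rank v)) => [lt|gt|e].
  - by apply: (allC (u, v)); rewrite /= uv.
  - by rewrite symC; apply: (allC (v, u)); rewrite /= adj_sym uv.
  (* Equal labels would make the edge a loop. *)
  - by move: uv; rewrite (enum_rank_inj (val_inj e)) adj_irr.
by case/andP => /= uv _; apply: (implyP (allC u v)).
Qed.

Lemma edge_sumZ (R : rcfType) (G : sgraph) c (F : G -> G -> R) :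
  c * edge_sum F = edge_sum (fun u v => c * F u v).
Proof.
by rewrite /edge_sum mulr_sumr; apply: eq_bigr => u _; rewrite mulr_sumr.
Qed.

(** * Degrees and connectedness *)

Section Degrees.
Variable G : sgraph.
Implicit Types u v w : G.

Lemma deg_le_pred u : (deg u <= #|G|.-1)%N.
Proof.
rewrite -(cardsC1 u); apply: subset_leq_card; apply/subsetP => v.
by rewrite !inE; apply: contraTneq => ->; rewrite adj_irr.
Qed.

(** The neighbourhood of [w] lies in the complement of [w], which has the same cardinality. *)
Lemma deg_eq_pred w : deg w = #|G|.-1 -> forall v, adj w v = (v != w).
Proof.
move=> dw v; have /eqP/setP/(_ v) : [set v | adj w v] == [set~ w].
  rewrite eqEcard cardsC1 -dw leqnn andbT; apply/subsetP => x.
  by rewrite !inE; apply: contraTneq => ->; rewrite adj_irr.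
by rewrite !inE.
Qed.

Lemma deg_gt0 u v : adj u v -> (0 < deg u)%N.
Proof. by move=> uv; apply/card_gt0P; exists v; rewrite inE. Qed.

Lemma connected_neighbour u :
  connected_graph G -> (1 < #|G|)%N -> exists v, adj u v.
Proof.
case=> _ conn gt1; have : (0 < #|[set~ u]|)%N by rewrite cardsC1; lia.
case/card_gt0P => w; rewrite !inE => wu.
case/connectP: (conn u w) => [[|v p] /=]; first by move=> _ e; rewrite e eqxx in wu.
by case/andP => uv _ _; exists v.
Qed.

(** The degree stays constant along every path from a fixed vertex. *)
Lemma regular_of_edges : connected_graph G ->
  (forall u v, adj u v -> deg u = deg v) -> regular_graph G.
Proof.
case=> /card_gt0P[u0 _] conn eqd; exists (deg u0) => u.
case/connectP: (conn u0 u) => p; elim: p u0 => [|x p IH] y /= => [_ ->//|].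
by case/andP => /eqd-> px /(IH _ px).
Qed.

End Degrees.

(** * Recognising complete graphs and stars *)

Lemma iso_deg (G H : sgraph) (f : G -> H) (u : G) : bijective f ->
  (forall u v, adj (f u) (f v) = adj u v) -> deg (f u) = deg u.
Proof.
move=> bijf adjf; rewrite /deg -(card_imset _ (bij_inj bijf)).
have [g fK gK] := bijf; apply: eq_card => y; rewrite inE -[y]gK adjf.
by rewrite mem_imset ?inE //; apply: bij_inj.
Qed.

Lemma complete_deg n (i : complete_graph n) : deg i = n.-1.
Proof.
rewrite /deg -[in RHS](card_ord n) -(cardsC1 i).
by apply: eq_card => j; rewrite !inE eq_sym.
Qed.

Lemma star_deg k (x : complete_bipartite_graph 1 k) :
  deg x = if x is inl _ then k else 1%N.
Proof.
case: x => i; rewrite /deg.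
  rewrite -[RHS](card_ord k) -cardsT -(card_imset _ (@inr_inj 'I_1 'I_k)).
  by apply: eq_card => -[j|j]; rewrite !inE ?mem_imset ?inE //;
     [apply/esym/imsetP => -[]|exact: inr_inj].
rewrite -[RHS](card_ord 1) -cardsT -(card_imset _ (@inl_inj 'I_1 'I_k)).
by apply: eq_card => -[j|j]; rewrite !inE ?mem_imset ?inE //;
   [exact: inl_inj|apply/esym/imsetP => -[]].
Qed.

Lemma iso_complete (G : sgraph) :
  (forall u v : G, u != v -> adj u v) -> graph_iso G (complete_graph #|G|).
Proof.
move=> allG; exists enum_rank; first exact: enum_rank_bij.
move=> u v; rewrite /= /complete_adj (inj_eq enum_rank_inj).
by have [->|/allG->] := eqVneq u v; rewrite ?adj_irr.
Qed.

(** The vertex [w] becomes the centre; removing its label with [unlift] numbers the other vertices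
    by ['I_(#|G|.-1)]. *)
Lemma iso_star (G : sgraph) (w : G) :
    (forall u v : G, adj u v = (u == w) (+) (v == w)) ->
  graph_iso G (complete_bipartite_graph 1 #|G|.-1).
Proof.
move=> adjE.
pose f (u : G) : 'I_1 + 'I_(#|G|.-1) :=
  if unlift (enum_rank w) (enum_rank u) is Some j then inr j else inl ord0.
pose g (x : 'I_1 + 'I_(#|G|.-1)) : G :=
  if x is inr j then enum_val (lift (enum_rank w) j) else w.
exists f.
  exists g => [u|[i|j]]; rewrite /f /g.
  - by case: unliftP => [j <-|/enum_rank_inj->] //; rewrite enum_rankK.
  - by rewrite unlift_none (ord1 i).
  - by rewrite (enum_valK (lift (enum_rank w) j)) liftK.
(* The side on which [f u] lies tells whether [u] is [w], so bipartite adjacency becomes the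
   exclusive or. *)
have fE u : (if f u is inl _ then true else false) = (u == w).
  rewrite /f -(inj_eq enum_rank_inj); case: unliftP => [k ->|->]; last by rewrite eqxx.
  by rewrite eq_sym (negbTE (neq_lift _ _)).
by move=> u v; rewrite adjE -!fE /=; case: (f u); case: (f v).
Qed.

(** * Equality in the right-hand bound *)

Section ExtremalGraphs.
Variables (G : sgraph) (delta : nat).
Hypotheses (connG : connected_graph G) (gt1 : (1 < #|G|)%N).
Hypothesis mindegG : is_min_degree G delta.

(** The equality condition of [ag_scaled_ga_leif] at [d = delta] and [m = #|G|.-1], kept in natural
    numbers. *)
Definition extremal_edge (u v : G) : bool :=
  ((deg u == delta) && (deg v == #|G|.-1))
  || ((deg u == #|G|.-1) && (deg v == delta)).

Lemma extremal_edges_iso : (forall u v : G, adj u v -> extremal_edge u v) ->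
  graph_iso G (complete_bipartite_graph 1 #|G|.-1)
  \/ graph_iso G (complete_graph #|G|).
Proof.
move=> ext; have [u0 du0] := mindegG.1.
have [v0 uv0] := connected_neighbour u0 connG gt1.
have [w dw] : exists w : G, deg w = #|G|.-1.
  by case/orP: (ext _ _ uv0) => /andP[/eqP ? /eqP ?]; [exists v0|exists u0].
have adjw := deg_eq_pred dw.
(* If [delta] is [#|G|.-1], every degree is squeezed to that value. *)
have [edelta|ndelta] := eqVneq delta #|G|.-1.
  right; apply: iso_complete => u v uv; rewrite deg_eq_pred 1?eq_sym //.
  by apply/eqP; rewrite eqn_leq deg_le_pred -edelta mindegG.2.
left; apply: (iso_star (w := w)) => u v.
have degE x : x != w -> deg x = delta.
  rewrite -adjw => /ext; rewrite /extremal_edge dw eqxx eq_sym (negbTE ndelta) /=.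
  by move/eqP.
have [->|uw] := eqVneq u w; first by rewrite adjw.
have [->|vw] := eqVneq v w; first by rewrite adj_sym adjw uw.
(* Both ends now have degree [delta], so an edge between them would force [delta = #|G|.-1]. *)
apply: contraNF ndelta => /ext; rewrite /extremal_edge !degE //.
by rewrite eqxx andbT orbb.
Qed.

Lemma iso_extremal_edges :
    graph_iso G (complete_bipartite_graph 1 #|G|.-1)
    \/ graph_iso G (complete_graph #|G|) ->
  forall u v : G, adj u v -> extremal_edge u v.
Proof.
have [[u0 du0] mind] := mindegG.
case=> -[f bijf adjf] u v uv; rewrite /extremal_edge.
  have [g fK gK] := bijf.
  have degE x : deg x = if f x is inl _ then #|G|.-1 else 1%N.
    by rewrite -(iso_deg x bijf adjf) star_deg.
  have k0 : (0 < #|G|.-1)%N by lia.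
  (* A leaf exists since [#|G|.-1] is positive, so [delta <= 1]; a neighbour of [u0] gives the
     converse. *)
  have delta1 : delta = 1%N.
    apply/eqP; rewrite eqn_leq; apply/andP; split.
      by have := mind (g (inr (Ordinal k0))); rewrite degE gK.
    by have [v0 uv0] := connected_neighbour u0 connG gt1; rewrite -du0 (deg_gt0 uv0).
  move: uv; rewrite -adjf !degE delta1 /=.
  by case: (f u) => ?; case: (f v) => ? //; rewrite !eqxx ?orbT.
have degE (x : G) : deg x = #|G|.-1 by rewrite -(iso_deg x bijf adjf) complete_deg.
by rewrite -du0 !degE !eqxx.
Qed.

End ExtremalGraphs.

(** * The one-vertex graph and the conclusion *)

Lemma edge_sum_card1 (R : rcfType) (G : sgraph) (F : G -> G -> R) :
  (#|G| <= 1)%N -> edge_sum F = 0.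
Proof.
move/card_le1P => G1; rewrite /edge_sum big1 // => u _; apply: big_pred0 => v.
have /(_ v) := G1 u isT; rewrite !inE => /esym/eqP->.
by rewrite adj_irr.
Qed.

Theorem theorem7 (R : rcfType) (G : sgraph) (n delta : nat)
    (connG : connected_graph G) (cardG : #|G| = n)
    (mindegG : is_min_degree G delta) :
  let c : R := (delta%:R + n%:R - 1) ^+ 2 / (4 * delta%:R * (n%:R - 1)) in
  [/\ GA R G <= AG R G,
      AG R G <= c * GA R G,
      GA R G = AG R G <-> regular_graph G
    & AG R G = c * GA R G <->
      graph_iso G (complete_bipartite_graph 1 n.-1)
      \/ graph_iso G (complete_graph n)].
Proof.
move=> c; subst n.
(* With one vertex the denominator of [c] is zero, but both indices vanish, so both equalities hold;
   the graph is regular and is [K_1]. *)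
have [le1|gt1] := leqP #|G| 1.
  have eqG (u v : G) : u = v.
    by have/card_le1P/(_ u isT v) := le1; rewrite !inE => /esym/eqP->.
  rewrite /AG /GA !edge_sum_card1 // mulr0; split=> //.
    by split=> // _; have [u du] := mindegG.1; exists delta => v; rewrite (eqG v u).
  by split=> // _; right; apply: iso_complete => u v; rewrite (eqG u v) eqxx.
have deg0 (u : G) : (0 < deg u)%N.
  by have [v] := connected_neighbour u connG gt1; apply: deg_gt0.
have [leGA eqGA] : GA R G <= AG R G
    ?= iff [forall u : G, forall v, adj u v ==> (deg u == deg v)].
  apply: edge_sum_leif => [u v|u v _]; first exact: eq_sym.
  by rewrite -(eqr_nat R); apply: ga_ag_leif; rewrite ltr0n.
have [leAG eqAG] : AG R G <= c * GA R G
    ?= iff [forall u : G, forall v, adj u v ==> extremal_edge delta u v].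
  rewrite /GA edge_sumZ; apply: edge_sum_leif => [u v|u v _].
    by rewrite /extremal_edge orbC andbC [X in _ || X]andbC.
  (* The truncated predecessor agrees with subtraction in [R] because [#|G|] is positive. *)
  have En : (#|G|%:R - 1 : R) = #|G|.-1%:R by rewrite -subn1 natrB // ltnW.
  rewrite /extremal_edge -!(eqr_nat R) /c -addrA En.
  have [[u0 du0] mind] := mindegG.
  by apply: ag_scaled_ga_leif; rewrite ?ltr0n ?ler_nat ?deg_le_pred ?mind // -du0.
split=> //.
- split=> [/eqP|[r dr]].
    rewrite eqGA => /'forall_forallP eqd; apply: regular_of_edges => // u v uv.
    by apply/eqP; apply: (implyP (eqd u v)).
  by apply/eqP; rewrite eqGA; apply/'forall_forallP => u v; rewrite !dr eqxx implybT.
- split=> [/eqP|iso].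
    rewrite eqAG => /'forall_forallP ext.
    by apply: (extremal_edges_iso connG gt1 mindegG) => u v; apply/implyP.
  apply/eqP; rewrite eqAG; apply/'forall_forallP => u v; apply/implyP.
  exact: (iso_extremal_edges connG gt1 mindegG).
Qed.
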